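(* Fix $\theta\in(0,1]$. For each $n\ge 1$ let $\pi=\pi_n$ be the probability distribution on $\{0,1\}^n$ given by $\pi(x)=\theta^{S(x)}(1+\theta)^{-n}$. Then the sequence, indexed by $n$, of lazy random walk Metropolis chains for $\pi_n$ on $\{0,1\}^n$ has cutoff at $\frac{1}{1+\theta}\,n\log n$ with a window of size $n$.
   Context: For $x\in\{0,1\}^n$, $S(x)=\sum_{i=1}^n x_i$ is the number of ones in $x$. Two states are neighbors, $x\sim y$, if they differ in exactly one coordinate. Lazy random walk Metropolis chain for a positive distribution $\pi$ on $\{0,1\}^n$: at each step, flip an independent fair coin. If heads, stay at the current state $x$. If tails, choose one of the $n$ neighbors $y$ of $x$ uniformly at random, move to $y$ with probability $\min(1,\pi(y)/\pi(x))$, and otherwise stay at $x$. For $\pi(x)=\theta^{S(x)}(1+\theta)^{-n}$ with $\theta\in(0,1]$, the transition matrix is: $P(x,y)=\frac1{2n}$ if $x\sim y$ and $S(x)>S(y)$; $P(x,y)=\frac{\theta}{2n}$ if $x\sim y$ and $S(x)<S(y)$; $P(x,x)=\frac12+\frac{n-S(x)}{2n}(1-\theta)$; and $P(x,y)=0$ otherwise. Total variation distance: $\|\mu-\nu\|=\max_A(\mu(A)-\nu(A))$. For the $n$-th chain, $d_n(t)=\max_x\|P^t(x,\cdot)-\pi\|$ for $t=0,1,2,\dots$ (non-integer times are rounded to integers, e.g. down). A sequence of chains has cutoff at $s_n$ with window size $w_n$ if $w_n=o(s_n)$, $\lim_{\alpha\to\infty}\liminf_{n\to\infty}d_n(s_n-\alpha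 w_n)=1$, and $\lim_{\alpha\to\infty}\limsup_{n\to\infty}d_n(s_n+\alpha w_n)=0$. *)

(* Defs.v *)
From HB Require Import structures.
From mathcomp Require Import all_boot all_order all_algebra.
From mathcomp Require Import all_classical all_reals all_analysis.

Set Implicit Arguments.
Unset Strict Implicit.
Unset Printing Implicit Defensive.

Import Order.TTheory GRing.Theory Num.Theory.
Import numFieldNormedType.Exports.

Local Open Scope classical_set_scope.
Local Open Scope ring_scope.

Section FiniteChain.
Context {R : realType} {T : finType}.
Implicit Types (mu nu pi : T -> R) (P : T -> T -> R).

(* The empty event contributes 0, so the default value 0 of the iterated
   maximum does not affect it. *)
Definition tv_dist mu nu : R :=
  \big[Num.max/0]_(A : {set T}) (\sum_(x in A) mu x - \sum_(x in A) nu x).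

Fixpoint step_prob P (t : nat) (x y : T) : R :=
  if t is t'.+1 then \sum_z step_prob P t' x z * P z y else (x == y)%:R.

Definition max_tv P pi (t : nat) : R :=
  \big[Num.max/0]_(x : T) tv_dist (step_prob P t x) pi.

(* Real times are rounded down; [Num.truncn] sends negative reals to 0. *)
Definition max_tv_at P pi (t : R) : R := max_tv P pi (Num.truncn t).

End FiniteChain.

(* The chains [P n] live on [T n], with limiting distributions [pi n]; s is
   the cutoff location and w the window size.  The lower and upper limits
   along n are taken in the extended reals. *)
Definition has_cutoff {R : realType} (T : nat -> finType)
    (P : forall n, T n -> T n -> R) (pi : forall n, T n -> R)
    (s w : nat -> R) : Prop :=
  [/\ w =o_\oo s,
      limn_einf (fun n => (max_tv_at (P n) (pi n) (s n - alpha * w n))%:E)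
        @[alpha --> +oo%R] --> 1%:E
    & limn_esup (fun n => (max_tv_at (P n) (pi n) (s n + alpha * w n))%:E)
        @[alpha --> +oo%R] --> 0%:E ].

Arguments has_cutoff {R} T P pi s w.

Definition cube (n : nat) : finType := {ffun 'I_n -> bool}.

Definition ones {n : nat} (x : cube n) : nat := (\sum_(i < n) x i)%N.

Definition neighbor {n : nat} (x y : cube n) : bool :=
  #|[pred i | x i != y i]| == 1%N.

(* Heads: stay at x.  Tails: z is the proposed neighbor, accepted with
   probability min(1, pi z / pi x). *)
Definition lazy_metropolis {R : realType} {n : nat} (pi : cube n -> R)
    (x y : cube n) : R :=
  2^-1 * (x == y)%:R +
  2^-1 * \sum_(z : cube n | neighbor x z) n%:R^-1 *
    (Num.min 1 (pi z / pi x) * (z == y)%:R +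
     (1 - Num.min 1 (pi z / pi x)) * (x == y)%:R).

Definition pi_theta {R : realType} (theta : R) (n : nat) (x : cube n) : R :=
  theta ^+ ones x * (1 + theta) ^- n.

Arguments pi_theta {R} theta n x.

(* Main.v *)
Require Import Defs.
From mathcomp Require Import all_boot all_order all_algebra.
From mathcomp Require Import all_classical all_reals all_analysis.
From mathcomp Require Import ring lra.

(** The chain updates one uniformly chosen coordinate at a time, and whether a
   flip is accepted depends on that coordinate only.  Let [site] be 1 on ones
   and [- theta] on zeros: this is the nonconstant eigenfunction of the
   dynamics of one coordinate.  Hence the products [walsh theta S] of [site]
   over a set [S] of coordinates diagonalize the chain on the cube, with
   eigenvalues [1 - #|S| * lambda / n], where [lambda := (1 + theta) / 2]
   ([walsh_eigen]).  As [theta <= 1], these eigenvalues lie in [0, 1].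

   Upper bound.  The chain is reversible, so by Cauchy-Schwarz the square of
   the distance at time [t] from a state [x] is at most
   [P^(2t)(x, x) / pi x - 1].  The spectral decomposition
   ([step_prob_spectral]) turns the return probability into a sum over [S],
   each eigenvalue is at most [expR (- #|S| * lambda / n)], and the sum becomes
   a binomial power, bounded by
   [expR (n / theta * expR (- (1 + theta) * t / n))] ([max_tv_sqr_le]).
   At [t = n * ln n / (1 + theta) + alpha * n] the factor [n] cancels and the
   bound depends only on [alpha], up to the rounding of [t]
   ([max_tv_after_cutoff]).

   Lower bound.  Start from all ones and observe the sum of [site] over the
   coordinates.  Its mean at time [t] is [n * (1 - lambda / n) ^+ t], while
   under [pi] it is centered.  Both second moments are computed from the
   eigenfunctions of pairs, and both variances are at most [n]: distinct
   coordinates are uncorrelated under [pi], and not positively correlated at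
   time [t] because [1 - 2 * lambda / n <= (1 - lambda / n) ^+ 2].  Chebyshev's
   inequality then separates the two laws by [1 - 8 * n / mean ^+ 2]
   ([max_tv_ge_second_moment]).  Before the cutoff, the mean is still at least
   [sqrt n] times an exponential in [alpha] ([max_tv_before_cutoff]).

   For fixed [alpha], both estimates hold for all large [n] with bounds that do
   not depend on [n], so they pass to the lower and upper limits; then [alpha] tends to
   infinity. *)

Import Order.TTheory GRing.Theory Num.Theory.
Import numFieldNormedType.Exports.

Local Open Scope classical_set_scope.
Local Open Scope ring_scope.

(** * Reversible chains and total variation on a finite type *)

Section FiniteChains.
Context {R : realType} {T : finType}.
Implicit Types (mu nu pi f : T -> R) (P : T -> T -> R) (x y : T) (t : nat).

Lemma sum_delta_l x f : \sum_y (x == y)%:R * f y = f x.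
Proof.
rewrite (bigD1 x) //= eqxx mul1r big1 ?addr0 // => y /negbTE.
by rewrite eq_sym => ->; rewrite mul0r.
Qed.

Lemma step_probD P s t x y :
  step_prob P (s + t) x y = \sum_z step_prob P s x z * step_prob P t z y.
Proof.
elim: t y => [|t IH] y.
  rewrite addn0 -[LHS](sum_delta_l y (step_prob P s x)).
  by apply: eq_bigr => z _; rewrite /= mulrC eq_sym.
rewrite addnS /=; under eq_bigr do rewrite IH mulr_suml.
rewrite exchange_big /=; apply: eq_bigr => z _; rewrite mulr_sumr.
by apply: eq_bigr => u _; rewrite mulrA.
Qed.

Lemma step_prob_ge0 P t x y :
  (forall x y, 0 <= P x y) -> 0 <= step_prob P t x y.
Proof.
move=> P0; elim: t y => [|t IH] y /=; first exact: ler0n.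
by apply: sumr_ge0 => z _; rewrite mulr_ge0.
Qed.

Lemma step_prob_eigen {P f} {c : R} :
  (forall x, \sum_y P x y * f y = c * f x) ->
  forall t x, \sum_y step_prob P t x y * f y = c ^+ t * f x.
Proof.
move=> Pf; elim=> [|t IH] x /=; first by rewrite sum_delta_l mul1r.
under eq_bigr do rewrite mulr_suml.
rewrite exchange_big /=.
under eq_bigr => z _ do [under eq_bigr do rewrite -mulrA; rewrite -mulr_sumr Pf].
by rewrite exprS -mulrA -IH mulr_sumr; apply: eq_bigr => z _; rewrite mulrCA.
Qed.

Lemma step_prob_sum1 P t x :
  (forall x, \sum_y P x y = 1) -> \sum_y step_prob P t x y = 1.
Proof.
move=> P1; have E : forall x, \sum_y P x y * (fun=> 1) y = 1 * (fun=> 1) x.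
  by move=> u /=; rewrite mulr1 -[RHS](P1 u); apply: eq_bigr => y _; rewrite mulr1.
have := step_prob_eigen E t x; rewrite expr1n mulr1 => <-.
by apply: eq_bigr => y _; rewrite mulr1.
Qed.

Lemma step_prob_reversible P pi t x y :
  (forall x y, pi x * P x y = pi y * P y x) ->
  pi x * step_prob P t x y = pi y * step_prob P t y x.
Proof.
move=> rev; elim: t x y => [|t IH] x y.
  by rewrite /= [y == x]eq_sym; case: eqP => [->|]; rewrite ?mulr0.
rewrite -[in RHS]add1n step_probD /= !mulr_sumr; apply: eq_bigr => z _.
by rewrite sum_delta_l mulrA IH mulrAC rev -mulrA.
Qed.

(** Reversibility moves [P] from [f] to the constant function, which it fixes:
   the mean is equal to [c] times itself. *)
Lemma stationary_eigen_mean0 {P pi f} {c : R} :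
  (forall x y, pi x * P x y = pi y * P y x) ->
  (forall x, \sum_y P x y = 1) ->
  (forall x, \sum_y P x y * f y = c * f x) -> c != 1 ->
  \sum_x pi x * f x = 0.
Proof.
move=> rev P1 Pf c1; apply/eqP.
have /eqP : c * (\sum_x pi x * f x) = \sum_x pi x * f x.
  rewrite mulr_sumr; under eq_bigr do rewrite mulrCA -Pf mulr_sumr.
  rewrite exchange_big /=; apply: eq_bigr => y _.
  under eq_bigr do rewrite mulrA rev mulrAC.
  by rewrite -mulr_sumr P1 mulr1.
by rewrite -subr_eq0 -{2}[\sum_x _]mul1r -mulrBl mulf_eq0 subr_eq0 (negbTE c1).
Qed.

Lemma tv_dist_ge0 mu nu : 0 <= tv_dist mu nu.
Proof.
exact: bigmax_ge_id.
Qed.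

Lemma tv_dist_le1 mu nu :
  (forall x, 0 <= mu x) -> \sum_x mu x = 1 -> (forall x, 0 <= nu x) ->
  tv_dist mu nu <= 1.
Proof.
move=> mu0 mu1 nu0; apply: bigmax_le => // A _.
rewrite -mu1 (le_trans (y := \sum_(x in A) mu x)) //.
  by rewrite gerBl sumr_ge0.
by rewrite [leRHS](bigID (mem A)) /= lerDl sumr_ge0.
Qed.

Lemma max_tv_ge0 P pi t : 0 <= max_tv P pi t.
Proof.
exact: bigmax_ge_id.
Qed.

Lemma max_tv_le1 P pi t :
  (forall x y, 0 <= P x y) -> (forall x, \sum_y P x y = 1) ->
  (forall x, 0 <= pi x) -> max_tv P pi t <= 1.
Proof.
move=> P0 P1 pi0; apply: bigmax_le => // x _.
by apply: tv_dist_le1 => // [y|]; [exact: step_prob_ge0 | exact: step_prob_sum1].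
Qed.

(** On each event [A] this is Cauchy-Schwarz, obtained from
   [0 <= \sum_(x in A) pi x * (d x / pi x - s) ^+ 2], where [d := mu - pi] and
   [s := \sum_(x in A) d x]; the chi-square distance on the right is
   [\sum_x d x ^+ 2 / pi x]. *)
Lemma tv_dist_sqr_le_chi2 mu pi :
  (forall x, 0 < pi x) -> \sum_x pi x = 1 -> \sum_x mu x = 1 ->
  tv_dist mu pi ^+ 2 <= \sum_x mu x ^+ 2 / pi x - 1.
Proof.
move=> pi0 pi1 mu1.
have chiE : \sum_x mu x ^+ 2 / pi x - 1 = \sum_x (mu x - pi x) ^+ 2 / pi x.
  transitivity (\sum_x (mu x ^+ 2 / pi x - 2 * mu x + pi x)).
    rewrite !big_split /= sumrN -mulr_sumr mu1 pi1; lra.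
  by apply: eq_bigr => x _; field; rewrite gt_eqF.
have bound (A : {set T}) : (\sum_(x in A) mu x - \sum_(x in A) pi x) ^+ 2 <=
    \sum_x mu x ^+ 2 / pi x - 1.
  rewrite chiE -sumrB; set s := \sum_(x in A) _.
  apply: (le_trans (y := \sum_(x in A) (mu x - pi x) ^+ 2 / pi x)); last first.
    rewrite [leRHS](bigID (mem A)) /= lerDl sumr_ge0 // => x _.
    by rewrite divr_ge0 ?sqr_ge0 // ltW.
  have piA : \sum_(x in A) pi x <= 1.
    by rewrite -pi1 [leRHS](bigID (mem A)) /= lerDl sumr_ge0 // => x _; rewrite ltW.
  have : 0 <= \sum_(x in A) pi x * ((mu x - pi x) / pi x - s) ^+ 2.
    by apply: sumr_ge0 => x _; rewrite mulr_ge0 ?sqr_ge0 // ltW.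
  rewrite (eq_bigr (fun x => (mu x - pi x) ^+ 2 / pi x + (- (2 * s)) * (mu x - pi x)
     + s ^+ 2 * pi x)); last by move=> x _; field; rewrite gt_eqF.
  rewrite !big_split /= -!mulr_sumr -/s; have := sqr_ge0 s; nra.
have chi0 := le_trans (sqr_ge0 _) (bound finset.set0).
rewrite -[leRHS]sqr_sqrtr // lerXn2r ?nnegrE ?tv_dist_ge0 ?sqrtr_ge0 //.
apply: bigmax_le => [|A _]; first exact: sqrtr_ge0.
by rewrite (le_trans (ler_norm _)) // -sqrtr_sqr ler_sqrt // sqr_ge0.
Qed.

(** The sum over [y] of [P^t(x, y) ^+ 2 / pi y] is
   [P^t(x, y) * P^t(y, x) / pi x] summed over [y], by reversibility: the
   chi-square distance is a return probability after [2t] steps. *)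
Lemma tv_dist_sqr_le_return P pi t x :
  (forall x, 0 < pi x) -> \sum_x pi x = 1 -> (forall x, \sum_y P x y = 1) ->
  (forall x y, pi x * P x y = pi y * P y x) ->
  tv_dist (step_prob P t x) pi ^+ 2 <= step_prob P (t + t) x x / pi x - 1.
Proof.
move=> pi0 pi1 P1 rev.
apply: le_trans (tv_dist_sqr_le_chi2 _ _ pi0 pi1 (step_prob_sum1 _ t x P1)) _.
rewrite step_probD mulr_suml lerD2r le_eqVlt; apply/orP; left; apply/eqP.
apply: eq_bigr => y _.
have := step_prob_reversible _ _ t x y rev => E.
have px : pi x != 0 by rewrite gt_eqF.
have py : pi y != 0 by rewrite gt_eqF.
apply: (mulfI px); rewrite expr2 !mulrA [in LHS]E; field.
by rewrite px py.
Qed.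

(** The test event is that [f] exceeds half of its [mu]-mean.  Chebyshev's
   inequality bounds its [nu]-probability, and the [mu]-probability of its
   complement, by [4 * v / m ^+ 2]. *)
Lemma tv_dist_ge_second_moment mu nu f (m v : R) :
  (forall x, 0 <= mu x) -> (forall x, 0 <= nu x) -> \sum_x mu x = 1 ->
  0 < m -> \sum_x mu x * f x = m -> \sum_x mu x * f x ^+ 2 <= m ^+ 2 + v ->
  \sum_x nu x * f x ^+ 2 <= v ->
  1 - 8 * v / m ^+ 2 <= tv_dist mu nu.
Proof.
move=> mu0 nu0 mu1 m0 muf muf2 nuf2.
pose A := [set x | m / 2 < f x]%SET.
apply: (le_trans _ (le_bigmax _ _ A)).
have m20 : 0 < m ^+ 2 by rewrite exprn_gt0.
have nuA : (\sum_(x in A) nu x) * m ^+ 2 <= 4 * v.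
  rewrite mulr_suml (le_trans (y := 4 * \sum_x nu x * f x ^+ 2)) ?ler_wpM2l //.
  rewrite [leLHS]big_mkcond mulr_sumr; apply: ler_sum => x _ /=.
  rewrite inE; case: ifP => [mf|_]; last by rewrite mulr_ge0 // mulr_ge0 // sqr_ge0.
  by rewrite [leRHS]mulrCA ler_wpM2l //; nra.
have muA : (1 - \sum_(x in A) mu x) * m ^+ 2 <= 4 * v.
  have -> : 1 - \sum_(x in A) mu x = \sum_(x | x \notin A) mu x.
    by rewrite -mu1 [X in X - _](bigID (fun x => x \in A)) /= addrAC subrr add0r.
  rewrite mulr_suml (le_trans (y := 4 * \sum_x mu x * (f x - m) ^+ 2)) //.
    rewrite [leLHS]big_mkcond mulr_sumr; apply: ler_sum => x _ /=.
    rewrite inE -leNgt; case: ifP => [mf|_]; last by rewrite mulr_ge0 // mulr_ge0 // sqr_ge0.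
    by rewrite [leRHS]mulrCA ler_wpM2l //; nra.
  rewrite ler_wpM2l //.
  rewrite (eq_bigr (fun x => mu x * f x ^+ 2 + (- (2 * m)) * (mu x * f x) +
    m ^+ 2 * mu x)); last by move=> x _; ring.
  rewrite !big_split /= -!mulr_sumr muf mu1; lra.
rewrite -(ler_pM2r m20) mulrBl divfK ?gt_eqF //; lra.
Qed.

End FiniteChains.

(** * Metropolis chains on the cube *)

Definition flip {n : nat} (i : 'I_n) (x : cube n) : cube n :=
  [ffun j => if j == i then ~~ x j else x j].

Section Cube.
Context {n : nat}.
Implicit Types (x y : cube n) (i j : 'I_n).

Lemma flip_same i x : flip i x i = ~~ x i.
Proof. by rewrite ffunE eqxx. Qed.

Lemma flip_other i j x : j != i -> flip i x j = x j.
Proof. by rewrite ffunE => /negbTE ->. Qed.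

Lemma neighborE x y : neighbor x y = [exists i, y == flip i x].
Proof.
apply/card1P/existsP => [[i xyi]|[i /eqP ->]]; exists i.
  apply/eqP/ffunP => j; rewrite ffunE.
  have := xyi j; rewrite !inE; case: (j =P i) => [-> /esym|_].
    by case: (x i); case: (y i).
  by move/negbFE/eqP.
by move=> j; rewrite !inE ffunE; case: (j == i); rewrite ?eqxx //; case: (x j).
Qed.

Lemma neighbor_sym x y : neighbor x y = neighbor y x.
Proof. by congr (_ == _); apply: eq_card => i; rewrite !inE eq_sym. Qed.

Lemma sum_neighbor {R : realType} x (F : cube n -> R) :
  \sum_(z | neighbor x z) F z = \sum_i F (flip i x).
Proof.
have inj : injective (flip ^~ x).
  move=> i j /= /ffunP /(_ i); rewrite !ffunE eqxx; case: eqP => // _.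
  by case: (x i).
rewrite -(big_imset (h := flip ^~ x) (A := predT)) /=; last by move=> i j _ _; apply: inj.
apply: eq_bigl => z; rewrite neighborE; apply/existsP/imsetP.
  by case=> i /eqP ->; exists i.
by case=> i _ ->; exists i.
Qed.

End Cube.

Section Metropolis.
Context {R : realType} {n : nat}.
Context { pi : cube n -> R}.
Hypothesis n_gt0 : (0 < n)%N.
Hypothesis pi_gt0 : forall x, 0 < pi x.
Implicit Types (x y z : cube n) (f : cube n -> R).

Lemma lazy_metropolis_ge0 x y : 0 <= lazy_metropolis pi x y.
Proof.
have a0 z : 0 <= Num.min 1 (pi z / pi x) by rewrite le_min ler01 divr_ge0 // ltW.
rewrite addr_ge0 // mulr_ge0 ?ler0n ?invr_ge0 ?ler0n //.
apply: sumr_ge0 => z _; rewrite mulr_ge0 ?invr_ge0 ?ler0n //.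
by rewrite addr_ge0 // mulr_ge0 ?ler0n // subr_ge0 ge_min lexx.
Qed.

Lemma lazy_metropolis_off_diag x y : x != y ->
  lazy_metropolis pi x y =
    (2 * n%:R)^-1 * Num.min 1 (pi y / pi x) * (neighbor x y)%:R.
Proof.
move=> xy; rewrite /lazy_metropolis (negbTE xy) mulr0 add0r.
rewrite (eq_bigr (fun z => n%:R^-1 * (Num.min 1 (pi z / pi x) * (z == y)%:R))); last first.
  by move=> z _; rewrite mulr0 addr0.
rewrite invfM -!mulrA; congr (_ * _); rewrite -mulr_sumr; congr (_ * _).
case nxy: (neighbor x y); last first.
  rewrite mulr0 big1 // => z; case: eqP => [->|]; rewrite ?nxy ?mulr0 //.
rewrite (bigD1 y) //= eqxx mulr1 big1 ?addr0 // => z /andP[_ /negbTE ->].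
by rewrite mulr0.
Qed.

(** The flow from [x] to a neighbor [y] is proportional to
   [Num.min (pi x) (pi y)], which is symmetric. *)
Lemma lazy_metropolis_reversible x y :
  pi x * lazy_metropolis pi x y = pi y * lazy_metropolis pi y x.
Proof.
have [->//|xy] := eqVneq x y.
have flow u v : pi u * Num.min 1 (pi v / pi u) = Num.min (pi u) (pi v).
  by rewrite minr_pMr ?ltW // mulr1 mulrC divfK ?gt_eqF.
rewrite !lazy_metropolis_off_diag 1?[y == x]eq_sym // neighbor_sym.
rewrite !mulrA; congr (_ * _).
by rewrite [LHS]mulrAC [RHS]mulrAC !flow minC.
Qed.

(** The generator form: averaging [f] over a step changes it by its average
   increment along accepted flips.  It reduces eigenfunction computations to
   one coordinate at a time. *)
Lemma lazy_metropolis_apply f x :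
  \sum_y lazy_metropolis pi x y * f y =
  f x + (2 * n%:R)^-1 *
    \sum_i Num.min 1 (pi (flip i x) / pi x) * (f (flip i x) - f x).
Proof.
have n0 : n%:R != 0 :> R by rewrite pnatr_eq0 -lt0n.
transitivity (2^-1 * f x + 2^-1 * \sum_(z | neighbor x z) n%:R^-1 *
   (Num.min 1 (pi z / pi x) * f z + (1 - Num.min 1 (pi z / pi x)) * f x)).
  under eq_bigr do rewrite mulrDl -!mulrA.
  rewrite big_split /= -!mulr_sumr sum_delta_l; congr (_ + _ * _).
  under eq_bigr do rewrite mulr_suml.
  rewrite exchange_big [RHS]mulr_sumr /=; apply: eq_bigr => z _.
  under eq_bigr do rewrite -mulrA mulrDl -!mulrA.
  by rewrite -mulr_sumr big_split /= -!mulr_sumr !sum_delta_l.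
rewrite sum_neighbor -mulr_sumr invfM -mulrA.
rewrite [in LHS](eq_bigr (fun i => f x +
  Num.min 1 (pi (flip i x) / pi x) * (f (flip i x) - f x))); last by move=> i _; ring.
rewrite big_split /= sumr_const card_ord -mulr_natl; field.
exact: n0.
Qed.

Lemma lazy_metropolis_sum1 x : \sum_y lazy_metropolis pi x y = 1.
Proof.
have := lazy_metropolis_apply (fun=> 1) x.
rewrite [X in _ * X]big1 ?mulr0 ?addr0 => [<-|i _]; last by rewrite subrr mulr0.
by apply: eq_bigr => y _; rewrite mulr1.
Qed.

End Metropolis.

(** * Diagonalization by products of one-coordinate eigenfunctions *)

(** The law of one coordinate under [pi_theta]. *)
Definition site_prob {R : realType} (theta : R) (b : bool) : R :=
  (if b then theta else 1) / (1 + theta).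

(** The nonconstant eigenfunction of the chain of a single coordinate.  It is
   normalized to have maximum 1 rather than unit variance, which avoids square
   roots; its variance under [site_prob theta] is [theta]. *)
Definition site {R : realType} (theta : R) (b : bool) : R := if b then 1 else - theta.

Definition walsh {R : realType} (theta : R) {n : nat} (S : {set 'I_n})
    (x : cube n) : R :=
  \prod_(i in S) site theta (x i).

Definition walsh_eigenvalue {R : realType} (theta : R) (n k : nat) : R :=
  1 - k%:R * ((1 + theta) / 2) / n%:R.

Section ProductMeasure.
Context {R : realType} {theta : R}.
Hypotheses (theta_gt0 : 0 < theta) (theta_le1 : theta <= 1).
Context {n : nat}.
Implicit Types (x y : cube n) (S : {set 'I_n}).

Lemma site_sqr_le1 b : site theta b ^+ 2 <= 1.
Proof. by rewrite /site; case: b; rewrite ?expr1n ?sqrrN ?exprn_ile1 ?(ltW theta_gt0). Qed.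

Lemma pi_thetaE x : pi_theta theta n x = \prod_i site_prob theta (x i).
Proof.
rewrite /pi_theta /ones big_split /= big_const_ord iter_mulr_1 exprVn -prodrXr.
by congr (_ / _); apply: eq_bigr => i _; case: (x i).
Qed.

Lemma pi_theta_gt0 x : 0 < pi_theta theta n x.
Proof. by rewrite /pi_theta divr_gt0 ?exprn_gt0 ?addr_gt0. Qed.

Lemma pi_theta_sum1 : \sum_x pi_theta theta n x = 1.
Proof.
under eq_bigr do rewrite pi_thetaE.
rewrite -(bigA_distr_bigA (fun _ : 'I_n => site_prob theta)) /= big1 // => i _.
rewrite big_bool /site_prob /= -mulrDl addrC divff //.
by rewrite gt_eqF // addr_gt0.
Qed.

(** The coordinates other than [i] cancel in the ratio: this is where the
   product form of the measure decouples the coordinates. *)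
Lemma acceptance_flip i x :
  Num.min 1 (pi_theta theta n (flip i x) / pi_theta theta n x) =
  if x i then 1 else theta.
Proof.
have t0 := lt0r_neq0 theta_gt0.
have t1 : 1 + theta != 0 by rewrite gt_eqF // addr_gt0.
rewrite !pi_thetaE (bigD1 i) //= [in X in _ / X](bigD1 i) //= flip_same.
rewrite (eq_bigr (fun j => site_prob theta (x j))); last by move=> j ji; rewrite flip_other.
set p := \prod_(j | _) _.
have p0 : p != 0.
  apply/prodf_neq0 => j _; rewrite mulf_neq0 ?invr_eq0 //.
  by case: (x j); rewrite ?oner_eq0.
rewrite -mulf_div divff // mulr1 /site_prob; case: (x i) => /=.
  rewrite (_ : _ / _ = theta^-1); last by field; rewrite t0.
  by apply/min_idPl; rewrite invf_ge1.
rewrite (_ : _ / _ = theta); last by field.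
exact/min_idPr.
Qed.

(** On one coordinate, both jumps multiply the increment of [site] by the
   acceptance probability into [- (1 + theta) * site]: from a one,
   [- theta - 1]; from a zero, [theta * (1 + theta)]. *)
Lemma walsh_flip S i x :
  (if x i then 1 else theta) * (walsh theta S (flip i x) - walsh theta S x) =
  - ((1 + theta) * (i \in S)%:R * walsh theta S x).
Proof.
rewrite /walsh; have [iS|iS] := boolP (i \in S); last first.
  rewrite mulr0 mul0r oppr0 (_ : \prod_(j in S) _ = \prod_(j in S) site theta (x j)).
    by rewrite subrr mulr0.
  by apply: eq_bigr => j jS; rewrite flip_other //; apply: contraNneq iS => <-.
rewrite !(bigD1 i iS) /= flip_same.
rewrite (eq_bigr (fun j => site theta (x j))); last first.
  by move=> j /andP[_ ji]; rewrite flip_other.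
by rewrite /site; case: (x i) => /=; ring.
Qed.

(** Each coordinate of [S] is proposed with probability [1 / (2 * n)] and then
   contributes [- (1 + theta)] to the relative increment; the coordinates
   outside [S] contribute nothing. *)
Lemma walsh_eigen S x : (0 < n)%N ->
  \sum_y lazy_metropolis (pi_theta theta n) x y * walsh theta S y =
  walsh_eigenvalue theta n #|S| * walsh theta S x.
Proof.
move=> n0; rewrite lazy_metropolis_apply //.
under eq_bigr do rewrite acceptance_flip walsh_flip.
rewrite sumrN -mulr_suml -mulr_sumr -natr_sum -big_mkcond /= sum1_card.
rewrite /walsh_eigenvalue; field.
by rewrite pnatr_eq0 -lt0n.
Qed.

(** On one coordinate [site_prob b * (1 + site a * site b / theta)] is the
   indicator of [a = b].  Multiplying over the coordinates and expanding the
   product over subsets gives the completeness of the family [walsh]. *)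
Lemma walsh_complete x y :
  pi_theta theta n y * (\sum_S walsh theta S x * walsh theta S y / theta ^+ #|S|) =
  (x == y)%:R.
Proof.
have t0 := lt0r_neq0 theta_gt0.
have t1 : 1 + theta != 0 by rewrite gt_eqF // addr_gt0.
under eq_bigr => S _.
  rewrite /walsh -prodr_const -prodfV -!big_split /= big_mkcond /=.
  over.
rewrite -(bigA_distr _ _
  (fun i => site theta (x i) * site theta (y i) / theta) (fun=> 1)).
rewrite pi_thetaE -big_split /=.
rewrite (eq_bigr (fun i => (x i == y i)%:R)) => [|i _]; last first.
  by rewrite /site_prob /site; case: (x i); case: (y i) => /=; field; rewrite ?t0 ?t1.
have [->|xy] := eqVneq x y; first by rewrite big1 // => i _; rewrite eqxx.
have [i xyi] : exists i, x i != y i.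
  apply/existsP; rewrite -negb_forall; apply: contraNN xy => /forallP xy.
  by apply/eqP/ffunP => i; apply/eqP.
by rewrite (bigD1 i) //= (negbTE xyi) mul0r.
Qed.

(** At time 0 this is completeness; a further step acts on the factor
   [walsh theta S y] by its eigenvalue, after reversing the step. *)
Lemma step_prob_spectral t x y : (0 < n)%N ->
  step_prob (lazy_metropolis (pi_theta theta n)) t x y =
  pi_theta theta n y *
    \sum_(S : {set 'I_n}) walsh_eigenvalue theta n #|S| ^+ t *
      (walsh theta S x * walsh theta S y / theta ^+ #|S|).
Proof.
move=> n0; elim: t y => [|t IH] y /=.
  by rewrite -walsh_complete; under [in RHS]eq_bigr do rewrite mul1r.
have rev := lazy_metropolis_reversible pi_theta_gt0.
under eq_bigr do rewrite IH mulrAC rev mulr_sumr.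
rewrite exchange_big mulr_sumr /=; apply: eq_bigr => S _.
transitivity (pi_theta theta n y *
  (walsh_eigenvalue theta n #|S| ^+ t * (walsh theta S x / theta ^+ #|S|)) *
  \sum_z lazy_metropolis (pi_theta theta n) y z * walsh theta S z).
  rewrite mulr_sumr; apply: eq_bigr => z _; ring.
by rewrite walsh_eigen // exprSr; ring.
Qed.

End ProductMeasure.

(** * Bounds on the distance at a fixed time *)

Section MixingBounds.
Context {R : realType} {theta : R}.
Hypotheses (theta_gt0 : 0 < theta) (theta_le1 : theta <= 1).
Context {n : nat}.
Hypothesis n_gt0 : (0 < n)%N.
Implicit Types (x : cube n) (S : {set 'I_n}) (k t : nat).

Local Notation P := (lazy_metropolis (pi_theta theta n)).
Local Notation pi := (pi_theta theta n).
Local Notation mu := (walsh_eigenvalue theta n).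

Let n_pos : 0 < n%:R :> R.
Proof. by rewrite ltr0n. Qed.

Lemma walsh_eigenvalue_ge0 k : (k <= n)%N -> 0 <= mu k.
Proof.
move=> kn; have : k%:R <= n%:R :> R by rewrite ler_nat.
rewrite /walsh_eigenvalue subr_ge0 ler_pdivrMr // mul1r => kn'.
rewrite (le_trans _ kn') // ler_piMr ?ler0n // ler_pdivrMr // mul1r; move: theta_le1; lra.
Qed.

Lemma walsh_eigenvalue_le_expR k :
  mu k <= expR (- (k%:R * ((1 + theta) / 2) / n%:R)).
Proof. exact: expR_ge1Dx. Qed.

(** Bounding each eigenvalue by an exponential linear in [#|S|], and each
   [walsh] by 1, makes the spectral sum at most [\sum_S q ^+ #|S|], which is
   [(q + 1) ^+ n <= expR (n * q)]. *)
Lemma return_prob_le t x :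
  step_prob P (t + t) x x / pi x <=
  expR (n%:R / theta * expR (- ((1 + theta) / n%:R * t%:R))).
Proof.
have pi0 := pi_theta_gt0 theta_gt0 x.
set q : R := expR (- ((1 + theta) / n%:R * t%:R)) / theta.
rewrite step_prob_spectral // mulrAC divff ?gt_eqF // mul1r.
have q0 : 0 < q by rewrite divr_gt0 ?expR_gt0.
apply: (le_trans (y := (q + 1) ^+ n)); last first.
  rewrite -mulrA [_^-1 * _]mulrC -/q expRM_natl lerXn2r ?nnegrE ?expR_ge0 //.
    by rewrite addr_ge0 // ltW.
  by rewrite addrC expR_ge1Dx.
have -> : (q + 1) ^+ n = \sum_(S : {set 'I_n}) q ^+ #|S|.
  have -> : (q + 1) ^+ n = \prod_(i < n) (q + 1).
    by rewrite big_const_ord iter_mulr_1.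
  rewrite (bigA_distr _ _ (fun=> q) (fun=> 1)).
  by apply: eq_bigr => S _; rewrite -big_mkcond prodr_const.
apply: ler_sum => S _; rewrite -expr2 /q expr_div_n mulrA.
rewrite ler_pM2r ?invr_gt0 ?exprn_gt0 //.
have mu0 : 0 <= mu #|S|.
  by apply: walsh_eigenvalue_ge0; rewrite -[X in (_ <= X)%N]card_ord max_card.
have W1 : walsh theta S x ^+ 2 <= 1.
  rewrite /walsh -prodrXl; apply: (le_trans (y := \prod_(i in S) 1)).
    by apply: ler_prod => i _; rewrite sqr_ge0 site_sqr_le1.
  by rewrite big1.
apply: (le_trans (y := mu #|S| ^+ (t + t))).
  by rewrite ler_piMr // exprn_ge0.
apply: (le_trans (y := expR (- (#|S|%:R * ((1 + theta) / 2) / n%:R)) ^+ (t + t))).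
  by rewrite lerXn2r ?nnegrE ?expR_ge0 // walsh_eigenvalue_le_expR.
rewrite -!expRM_natl ler_expR natrD le_eqVlt; apply/orP; left; apply/eqP.
by field; rewrite gt_eqF.
Qed.

Lemma max_tv_sqr_le t :
  max_tv P pi t ^+ 2 <=
  expR (n%:R / theta * expR (- ((1 + theta) / n%:R * t%:R))) - 1.
Proof.
have pi0 := pi_theta_gt0 theta_gt0.
have pi1 := pi_theta_sum1 theta_gt0.
have tv_le x : tv_dist (step_prob P t x) pi ^+ 2 <=
    expR (n%:R / theta * expR (- ((1 + theta) / n%:R * t%:R))) - 1.
  apply: le_trans (tv_dist_sqr_le_return _ _ _ _ (pi0 n) (pi1 n) _ _) _.
  - exact: lazy_metropolis_sum1.
  - exact: lazy_metropolis_reversible.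
  - by rewrite lerD2r return_prob_le.
have b0 := le_trans (sqr_ge0 _) (tv_le [ffun=> true]).
rewrite -[leRHS]sqr_sqrtr // lerXn2r ?nnegrE ?max_tv_ge0 ?sqrtr_ge0 //.
apply: bigmax_le => [|x _]; first exact: sqrtr_ge0.
by rewrite (le_trans (ler_norm _)) // -sqrtr_sqr ler_sqrt // sqr_ge0.
Qed.

(** The statistic that detects a late start from the all-ones state. *)
Definition site_sum x : R := \sum_i site theta (x i).

(** Expanding the square over pairs [(i, j)]: a diagonal pair contributes at
   most 1 and an off-diagonal pair is the mean of [walsh] on a set of two
   coordinates, at most [c]. *)
Lemma mean_site_sum_sqr_le (nu : cube n -> R) (c : R) :
  (forall x, 0 <= nu x) -> \sum_x nu x = 1 -> 0 <= c ->
  (forall S, #|S| = 2%N -> \sum_x nu x * walsh theta S x <= c) ->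
  \sum_x nu x * site_sum x ^+ 2 <= n%:R ^+ 2 * c + n%:R.
Proof.
move=> nu0 nu1 c0 nuW.
have pair i j : \sum_x nu x * (site theta (x i) * site theta (x j)) <= c + (i == j)%:R.
  case: eqVneq => [->|ij].
    apply: (le_trans (y := 1)); last by rewrite lerDr.
    rewrite -nu1; apply: ler_sum => x _; rewrite -expr2 ler_piMr //.
    exact: site_sqr_le1.
  rewrite addr0; apply: le_trans (nuW [set i; j]%SET _); last by rewrite cards2 ij.
  by apply: ler_sum => x _; rewrite /walsh big_setU1 ?inE //= big_set1.
rewrite (eq_bigr (fun x => \sum_i \sum_j
    nu x * (site theta (x i) * site theta (x j)))); last first.
  move=> x _; rewrite expr2 /site_sum mulr_suml mulr_sumr; apply: eq_bigr => i _.
  by rewrite !mulr_sumr.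
rewrite exchange_big /=.
apply: (le_trans (y := \sum_(i < n) (n%:R * c + 1))); last first.
  by rewrite sumr_const card_ord -[leLHS]mulr_natl mulrDr mulr1 mulrA.
apply: ler_sum => i _; rewrite exchange_big /=.
apply: (le_trans (ler_sum _ (fun j _ => pair i j))).
rewrite big_split /= sumr_const card_ord mulr_natl lerD2l.
by rewrite (bigD1 i) //= eqxx big1 ?addr0 // => j; rewrite eq_sym => /negbTE ->.
Qed.

Lemma walsh_set1 i x : walsh theta [set i]%SET x = site theta (x i).
Proof. by rewrite /walsh big_set1. Qed.

Lemma mean_site_sum (nu : cube n -> R) :
  \sum_x nu x * site_sum x = \sum_i \sum_x nu x * walsh theta [set i]%SET x.
Proof.
rewrite exchange_big /=; apply: eq_bigr => x _; rewrite -mulr_sumr.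
by congr (_ * _); apply: eq_bigr => i _; rewrite walsh_set1.
Qed.

(** From the all-ones state every [walsh] starts at 1, so the mean of
   [walsh theta S] at time [t] is [mu #|S| ^+ t], whereas it is 0 under [pi] for
   [S] nonempty.  As [mu 2 <= mu 1 ^+ 2], the second moment of [site_sum]
   exceeds the square of its mean by at most [n] under both laws. *)
Lemma max_tv_ge_second_moment t : (1 < n)%N -> 0 < mu 1 ->
  1 - 8 / (n%:R * mu 1 ^+ (t + t)) <= max_tv P pi t.
Proof.
move=> n1 mu1_gt0.
pose x1 : cube n := [ffun=> true].
have W1 S : walsh theta S x1 = 1.
  by rewrite /walsh big1 // => i _; rewrite /site ffunE.
have pi0 x : 0 <= pi x := ltW (pi_theta_gt0 theta_gt0 x).
have P0 := lazy_metropolis_ge0 (pi_theta_gt0 (n := n) theta_gt0).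
have P1 := lazy_metropolis_sum1 (pi := pi) n_gt0.
have PW S : \sum_y step_prob P t x1 y * walsh theta S y = mu #|S| ^+ t.
  rewrite (step_prob_eigen (c := mu #|S|)) ?W1 ?mulr1 // => x.
  exact: walsh_eigen.
have piW S : (0 < #|S|)%N -> \sum_y pi y * walsh theta S y = 0.
  move=> S0; apply: (stationary_eigen_mean0 (P := P) (c := mu #|S|)) => //.
  - exact: lazy_metropolis_reversible (pi_theta_gt0 (n := n) theta_gt0).
  - by move=> x; exact: walsh_eigen.
  rewrite lt_eqF // /walsh_eigenvalue ltrBlDr ltrDl.
  by rewrite divr_gt0 // mulr_gt0 ?ltr0n // divr_gt0 // addr_gt0.
have m0 : 0 < n%:R * mu 1 ^+ t by rewrite mulr_gt0 // exprn_gt0.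
have mu21 : mu 2 <= mu 1 ^+ 2.
  rewrite /walsh_eigenvalue mul1r.
  set u := (1 + theta) / 2.
  have -> : 2%:R * u / n%:R = 2 * (u / n%:R) by rewrite mulrA.
  by have := sqr_ge0 (u / n%:R); lra.
apply: le_trans (le_bigmax _ _ x1).
(* The bound is [8 * v / m ^+ 2] with variance bound [v := n]. *)
have -> : 8 / (n%:R * mu 1 ^+ (t + t)) = 8 * n%:R / (n%:R * mu 1 ^+ t) ^+ 2.
  rewrite exprMn -exprM muln2 addnn; field.
  by rewrite -addnn exprD mulf_neq0 ?expf_neq0 ?gt_eqF.
apply: (tv_dist_ge_second_moment _ _ site_sum) => //.
- by move=> x; exact: step_prob_ge0.
- exact: step_prob_sum1.
- rewrite mean_site_sum (eq_bigr (fun=> mu 1 ^+ t)) => [|i _]; last by rewrite PW cards1.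
  by rewrite sumr_const card_ord mulr_natl.
- rewrite exprMn; apply: mean_site_sum_sqr_le.
  + by move=> x; exact: step_prob_ge0.
  + exact: step_prob_sum1.
  + by rewrite sqr_ge0.
  move=> S S2; rewrite PW S2 -exprM mulnC exprM.
  by rewrite lerXn2r ?nnegrE ?sqr_ge0 ?walsh_eigenvalue_ge0.
- rewrite -[leRHS]add0r -[X in _ <= X + _](mulr0 (n%:R ^+ 2)).
  apply: mean_site_sum_sqr_le => //; first exact: pi_theta_sum1.
  by move=> S S2; rewrite piW ?S2.
Qed.

End MixingBounds.

(** * Lower and upper limits, and inequalities for the exponential *)

Section LimitBounds.
Context {R : realType}.

Lemma limn_einf_ge (u : (\bar R)^nat) (c : \bar R) :
  (\forall n \near \oo, (c <= u n)%E) -> (c <= limn_einf u)%E.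
Proof.
case=> N _ cu; rewrite limn_einf_lim; apply: lime_ge; first exact: is_cvg_einfs.
near=> n; apply: le_ereal_inf_tmp => _ [k /= nk <-]; apply: cu => /=.
by apply: leq_trans nk; near: n; exact: nbhs_infty_ge.
Unshelve. all: by end_near.
Qed.

Lemma limn_esup_le (u : (\bar R)^nat) (c : \bar R) :
  (\forall n \near \oo, (u n <= c)%E) -> (limn_esup u <= c)%E.
Proof.
case=> N _ uc; rewrite limn_esup_lim; apply: lime_le; first exact: is_cvg_esups.
near=> n; apply: ge_ereal_sup => _ [k /= nk <-]; apply: uc => /=.
by apply: leq_trans nk; near: n; exact: nbhs_infty_ge.
Unshelve. all: by end_near.
Qed.

Lemma near_ln_nat_ge (c : R) : \forall n \near \oo, c <= ln n%:R.
Proof.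
near=> n; rewrite -(expRK c) ler_ln ?posrE ?expR_gt0 //.
  by near: n; exact: nbhs_infty_ger.
by rewrite ltr0n; near: n; exact: nbhs_infty_gt.
Unshelve. all: by end_near.
Qed.

Lemma cvg_expR_affine (a b : R) : 0 < b ->
  expR (a - b * x) @[x --> +oo] --> 0.
Proof.
move=> b0; rewrite (_ : (fun x => _) = (fun x => expR a * expR (- (b * x)))).
  rewrite -[X in _ --> X](mulr0 (expR a)); apply: cvgMr.
  apply: (cvg_comp (fun x => b * x) (fun y => expR (- y))); last exact: cvgr_expR.
  by apply: gt0_cvgMry => //; exact: cvg_id.
by apply/funext => x; rewrite expRD.
Qed.

(** This is [1 + v <= expR v] at [v := u / (1 - u)], where
   [1 + v = (1 - u)^-1]. *)
Lemma expR_le_1B (u : R) : u < 1 -> expR (- (u / (1 - u))) <= 1 - u.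
Proof.
move=> u1; have v0 : 0 < 1 - u by rewrite subr_gt0.
rewrite expRN -[leRHS]invrK lef_pV2 ?posrE ?invr_gt0 ?expR_gt0 //.
apply: le_trans (expR_ge1Dx _); rewrite le_eqVlt; apply/orP; left; apply/eqP.
by field; rewrite gt_eqF.
Qed.

End LimitBounds.

(** * Estimates around the cutoff time *)

Section Cutoff.
Context {R : realType} {theta : R}.
Hypotheses (theta_gt0 : 0 < theta) (theta_le1 : theta <= 1).

Let s (n : nat) : R := (1 + theta)^-1 * (n%:R * ln n%:R).
Let d n (t : R) := max_tv_at (lazy_metropolis (pi_theta theta n)) (pi_theta theta n) t.

Let theta1_gt0 : 0 < 1 + theta.
Proof. by rewrite addr_gt0. Qed.

(** The 2 in the exponent is the price of rounding the time down: one step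
   costs at most [(1 + theta) / n <= 2]. *)
Lemma max_tv_after_cutoff n (alpha : R) : (0 < n)%N -> 0 <= alpha ->
  d n (s n + alpha * n%:R) <=
  Num.sqrt (expR (theta^-1 * expR (2 - (1 + theta) * alpha)) - 1).
Proof.
move=> n0 a0; have n1 : 1 <= n%:R :> R by rewrite ler1n.
have np : 0 < n%:R :> R by rewrite ltr0n.
have sa0 : 0 <= s n + alpha * n%:R.
  by rewrite addr_ge0 ?mulr_ge0 ?invr_ge0 ?ln_ge0 // ltW.
have /andP[_ tlt] := truncn_itv sa0; rewrite -natr1 in tlt.
rewrite /d /max_tv_at; set t := Num.trunc _ in tlt *.
rewrite -[leLHS]ger0_norm ?max_tv_ge0 // -sqrtr_sqr.
have pow_ge0 (u : R) : 0 <= u -> 0 <= expR u - 1.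
  by move=> u0; rewrite subr_ge0 -expR0 ler_expR.
rewrite ler_sqrt; last by rewrite pow_ge0 // mulr_ge0 ?expR_ge0 ?invr_ge0 ?ltW.
apply: le_trans (max_tv_sqr_le theta_gt0 theta_le1 n0 t) _.
rewrite lerD2r ler_expR [n%:R / theta]mulrC -[leLHS]mulrA ler_pM2l ?invr_gt0 //.
rewrite -{1}[n%:R](lnK (x := n%:R)) ?posrE // -expRD ler_expR.
have rate : (1 + theta) / n%:R * (s n + alpha * n%:R) =
    ln n%:R + (1 + theta) * alpha.
  by rewrite /s; field; rewrite !gt_eqF.
have loss : (1 + theta) / n%:R <= 2.
  by rewrite ler_pdivrMr //; move: theta_le1; lra.
have : (1 + theta) / n%:R * (s n + alpha * n%:R) <= (1 + theta) / n%:R * (t%:R + 1).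
  by rewrite ler_pM2l ?divr_gt0 // ltW.
by rewrite rate mulrDr mulr1; lra.
Qed.

(** By the second-moment bound it is enough that
   [n * (1 - lambda / n) ^+ (2 * t)] is at least
   [expR ((1 + theta) * alpha - 1)], where [lambda := (1 + theta) / 2].
   Replacing [1 - lambda / n] by [expR (- lambda / (n - lambda))] instead of
   [expR (- lambda / n)] costs [ln n * lambda / (n - lambda)] in the exponent,
   which is at most 1 since [ln n <= n - 1]; hence the 1 in the statement. *)
Lemma max_tv_before_cutoff n (alpha : R) : (1 < n)%N -> 0 <= alpha ->
  0 <= s n - alpha * n%:R ->
  1 - 8 * expR (1 - (1 + theta) * alpha) <= d n (s n - alpha * n%:R).
Proof.
move=> n1 a0 sa0; have n0 : (0 < n)%N by apply: ltnW.
have n2 : 2 <= n%:R :> R by rewrite ler_nat.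
have np : 0 < n%:R :> R by rewrite ltr0n.
have /andP[tle _] := truncn_itv sa0.
rewrite /d /max_tv_at; set t := Num.trunc _ in tle *.
set lam : R := (1 + theta) / 2.
have lam0 : 0 < lam by rewrite divr_gt0.
have lam1 : lam <= 1 by rewrite /lam; move: theta_le1; lra.
have nl : 0 < n%:R - lam by lra.
have muE : walsh_eigenvalue theta n 1 = 1 - lam / n%:R.
  by rewrite /walsh_eigenvalue mul1r.
have u1 : lam / n%:R < 1 by rewrite ltr_pdivrMr //; lra.
have mu_ge : expR (- (lam / n%:R / (1 - lam / n%:R))) <= walsh_eigenvalue theta n 1.
  by rewrite muE expR_le_1B.
have mu0 : 0 < walsh_eigenvalue theta n 1 := lt_le_trans (expR_gt0 _) mu_ge.
apply: le_trans (max_tv_ge_second_moment theta_gt0 theta_le1 n0 t n1 mu0).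
rewrite lerD2l lerN2 ler_pM2l // -[leRHS]invrK -expRN lef_pV2 ?posrE ?expR_gt0
  ?mulr_gt0 ?exprn_gt0 //.
apply: (le_trans
  (y := n%:R * expR (- (lam / n%:R / (1 - lam / n%:R))) ^+ (t + t))); last first.
  by rewrite ler_pM2l // lerXn2r ?nnegrE ?expR_ge0 // ltW.
rewrite -expRM_natl -{1}[n%:R](lnK (x := n%:R)) ?posrE // -expRD ler_expR.
have -> : lam / n%:R / (1 - lam / n%:R) = lam / (n%:R - lam).
  by field; rewrite !gt_eqF // subr_gt0.
have lnn : ln n%:R <= n%:R - 1 :> R.
  have := le_ln1Dx (x := n%:R - 1 : R); rewrite addrCA subrr addr0; apply; lra.
have lnn0 : 0 <= ln n%:R :> R by rewrite ln_ge0 // (le_trans _ n2) // ler1n.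
have tlam : (t + t)%:R * lam <= n%:R * (ln n%:R - (1 + theta) * alpha).
  have : (1 + theta) * t%:R <= (1 + theta) * (s n - alpha * n%:R) by rewrite ler_pM2l.
  have -> : (1 + theta) * (s n - alpha * n%:R) = n%:R * (ln n%:R - (1 + theta) * alpha).
    by rewrite /s; field; rewrite gt_eqF.
  by rewrite natrD /lam; lra.
have : (t + t)%:R * (lam / (n%:R - lam)) <= ln n%:R - (1 + theta) * alpha + 1.
  rewrite mulrA ler_pdivrMr // (le_trans tlam) //.
  have : 0 <= lam * ((1 + theta) * alpha) by rewrite !mulr_ge0 // ltW.
  have : lam * ln n%:R <= ln n%:R by rewrite ler_piMl.
  nra.
by rewrite mulrN; lra.
Qed.

End Cutoff.

Theorem theorem1 (R : realType) (theta : R)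
    (theta_gt0 : 0 < theta) (theta_le1 : theta <= 1) :
  has_cutoff cube
    (fun n : nat => lazy_metropolis (pi_theta theta n))
    (fun n : nat => pi_theta theta n)
    (fun n : nat => (1 + theta)^-1 * (n%:R * ln n%:R))
    (fun n : nat => n%:R).
Proof.
have theta1_gt0 : 0 < 1 + theta by rewrite addr_gt0.
pose s n : R := (1 + theta)^-1 * (n%:R * ln n%:R).
pose d n (t : R) : R :=
  max_tv_at (lazy_metropolis (pi_theta theta n)) (pi_theta theta n) t.
have d_ge0 n t : 0 <= d n t by exact: max_tv_ge0.
have d_le1 n t : (0 < n)%N -> d n t <= 1.
  move=> n0; apply: max_tv_le1.
  - exact: lazy_metropolis_ge0 (pi_theta_gt0 theta_gt0).
  - exact: lazy_metropolis_sum1.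
  - by move=> x; rewrite ltW ?pi_theta_gt0.
(* This gives both [n = o(s n)] and, for fixed [alpha], nonnegative times
   [s n - alpha * n] for large [n]. *)
have s_dominates (c : R) : \forall n \near \oo, c * n%:R <= s n.
  near=> n; rewrite /s mulrCA mulrC ler_wpM2l // ler_pdivlMl //.
  by near: n; exact: near_ln_nat_ge.
split.
- apply/eqoP => eps eps0; near=> n.
  rewrite [leLHS]ger0_norm ?ler0n // -ler_pdivrMl //.
  apply: le_trans (ler_norm _).
  by near: n; exact: s_dominates.
- apply: (@squeeze_cvge _ _ _ _
    (fun alpha => (1 - 8 * expR (1 - (1 + theta) * alpha))%:E) _ (fun=> 1%:E)).
  + near=> alpha; have alpha0 : 0 <= alpha by near: alpha; exact: nbhs_pinfty_ge.
    apply/andP; split.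
      apply: limn_einf_ge; near=> n; rewrite lee_fin.
      apply: max_tv_before_cutoff => //; first by near: n; exact: nbhs_infty_gt.
      by rewrite subr_ge0; near: n; exact: s_dominates.
    apply: le_trans (limn_einf_sup _) _; apply: limn_esup_le; near=> n.
    by rewrite lee_fin d_le1 //; near: n; exact: nbhs_infty_gt.
  + apply: cvg_EFin; first exact: nearW.
    rewrite -[X in _ --> X](_ : 1 - 8 * 0 = 1); last by rewrite mulr0 subr0.
    apply: cvgB; first exact: cvg_cst.
    by apply: cvgMr; exact: cvg_expR_affine.
  + exact: cvg_cst.
- apply: (@squeeze_cvge _ _ _ _ (fun=> 0%:E) _
    (fun alpha => (Num.sqrt
       (expR (theta^-1 * expR (2 - (1 + theta) * alpha)) - 1))%:E)).
  + near=> alpha; have alpha0 : 0 <= alpha by near: alpha; exact: nbhs_pinfty_ge.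
    apply/andP; split.
      apply: le_trans (limn_einf_sup _); apply: limn_einf_ge; near=> n.
      by rewrite lee_fin; exact: d_ge0.
    apply: limn_esup_le; near=> n; rewrite lee_fin.
    by apply: max_tv_after_cutoff => //; near: n; exact: nbhs_infty_gt.
  + exact: cvg_cst.
  + apply: cvg_EFin; first exact: nearW.
    rewrite -[X in _ --> X](_ : Num.sqrt (expR (theta^-1 * 0) - 1) = 0); last first.
      by rewrite mulr0 expR0 subrr sqrtr0.
    apply: (cvg_comp _ Num.sqrt); last exact: sqrt_continuous.
    apply: cvgB; last exact: cvg_cst.
    apply: (cvg_comp _ expR); last exact: continuous_expR.
    by apply: cvgMr; exact: cvg_expR_affine.
Unshelve. all: by end_near.
Qed.
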